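(* Let $S$ be a Hermitian positive definite $n \times n$ matrix partitioned as $$S = \begin{bmatrix} A & B \\ B^* & C \end{bmatrix}$$ where $A$ is $n_A \times n_A$ with $1 \leq n_A < n$. Let $Z_A^* A Z_A = I$ and $Z_C^* C Z_C = I$ be inverse factorizations of $A$ and $C$, and let $$Z_0 = \begin{bmatrix} Z_A & 0 \\ 0 & Z_C \end{bmatrix}.$$ Then $\|\delta_0\|_2<1$ and the regular and localized iterative refinement (both defined in the context) started from $Z_0$ converge. Moreover, for a given level of accuracy $\|\delta_i\|_2<\varepsilon$, the number of iterations is bounded by $$k = \left\lceil\frac{\log\left(\frac{\log \varepsilon}{\log \left(1-\lambda_{\mathrm{min}}(S)/\lambda_{\mathrm{max}}(S)\right)}\right)}{\log(m+1)}\right\rceil.$$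
   Context: Matrices are complex, $^*$ denotes the conjugate transpose, $\|\cdot\|_2$ is the spectral norm, and $\lambda_{\mathrm{min}}(S)$, $\lambda_{\mathrm{max}}(S)$ are the smallest and largest eigenvalues of $S$. Let $m\geq 1$ be an integer, $b_0 = 1$, and $b_k = \frac{2k-1}{2k}b_{k-1}$ for $k=1,\dots,m$. Regular iterative refinement: $\delta_0=I-Z_0^*SZ_0$ and, for $i=0,1,\dots$, $Z_{i+1}=Z_i\sum_{k=0}^m b_k\delta_i^k$, $\delta_{i+1}=I-Z_{i+1}^*SZ_{i+1}$. Localized iterative refinement (mathematically equivalent to the regular one): $\delta_{0} = -\begin{bmatrix} 0 & Z_A^*BZ_C \\ Z_C^*B^*Z_A & 0 \end{bmatrix}$ and, for $i=0,1,\dots$, $M_{i} = Z_{i} (\sum_{k=1}^m b_k\delta_{i}^k)$, $Z_{i+1} = Z_{i} + M_{i}$, $\delta_{i+1} = \delta_{i} - Z_{i+1}^*(SM_{i}) - (M_{i}^*S)Z_{i}$. Convergence means convergence of $Z_i$ to an inverse factor of $S$, i.e. a matrix $Z$ with $ZZ^*=S^{-1}$; $\delta_i$ is the factorization error $I-Z_i^*SZ_i$ in iteration $i$. *)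

(* Defs.v *)
From HB Require Import structures.
From mathcomp Require Export all_boot all_order all_algebra.
From mathcomp Require Export all_classical all_reals all_analysis.
From mathcomp Require Export complex.

Set Implicit Arguments.
Unset Strict Implicit.
Unset Printing Implicit Defensive.

Import Order.TTheory GRing.Theory Num.Theory numFieldNormedType.Exports.

Local Open Scope classical_set_scope.
Local Open Scope complex_scope.
Local Open Scope sesquilinear_scope.
Local Open Scope ring_scope.

(* In the complex order, 0 < z forces z to be real. *)
Definition hermitian_posdef (R : realType) (n : nat) (S : 'M[R[i]]_n) : Prop :=
  S \is hermsymmx /\
  forall x : 'cV[R[i]]_n, x != 0 -> 0 < (x ^t* *m S *m x) 0 0.

Definition norm2 (R : realType) (n : nat) (x : 'cV[R[i]]_n) : R :=
  Num.sqrt (\sum_(i < n) Normc.normc (x i 0) ^+ 2).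

(* Operator norm induced by the Euclidean norm. *)
Definition spectral_norm (R : realType) (n : nat) (M : 'M[R[i]]_n) : R :=
  sup [set norm2 (M *m x) | x in [set x : 'cV[R[i]]_n | norm2 x = 1]].

(* lambda_min and lambda_max are meant for Hermitian matrices of positive size,
   whose spectrum is a finite nonempty set of reals. *)
Definition real_spectrum (R : realType) (n : nat) (S : 'M[R[i]]_n) : set R :=
  [set x : R | eigenvalue S x%:C].

Definition lambda_min (R : realType) (n : nat) (S : 'M[R[i]]_n) : R :=
  inf (real_spectrum S).

Definition lambda_max (R : realType) (n : nat) (S : 'M[R[i]]_n) : R :=
  sup (real_spectrum S).

Fixpoint b_coef (F : fieldType) (k : nat) : F :=
  if k is j.+1 then (2 * k%:R - 1) / (2 * k%:R) * b_coef F j else 1.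

Definition factorization_error (R : realType) (n : nat) (S Z : 'M[R[i]]_n) :
    'M[R[i]]_n :=
  1%:M - Z ^t* *m S *m Z.

Fixpoint regular_Z (R : realType) (n m : nat) (S Z0 : 'M[R[i]]_n) (i : nat) :
    'M[R[i]]_n :=
  if i is j.+1 then
    let Z := regular_Z m S Z0 j in
    Z *m (\sum_(0 <= k < m.+1)
            b_coef R[i] k *: factorization_error S Z ^+ k)
  else Z0.

Definition regular_delta (R : realType) (n m : nat) (S Z0 : 'M[R[i]]_n)
    (i : nat) : 'M[R[i]]_n :=
  factorization_error S (regular_Z m S Z0 i).

(* The state is the pair (Z_i, delta_i); delta_i is updated by the recursion
   and never recomputed from Z_i. *)
Definition localized_step (R : realType) (n m : nat) (S : 'M[R[i]]_n)
    (s : 'M[R[i]]_n * 'M[R[i]]_n) : 'M[R[i]]_n * 'M[R[i]]_n :=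
  let: (Z, delta) := s in
  let M := Z *m (\sum_(1 <= k < m.+1) b_coef R[i] k *: delta ^+ k) in
  let Z' := Z + M in
  (Z', delta - Z' ^t* *m (S *m M) - (M ^t* *m S) *m Z).

Definition localized_Z (R : realType) (n m : nat) (S Z0 delta0 : 'M[R[i]]_n)
    (i : nat) : 'M[R[i]]_n :=
  (iter i (localized_step m S) (Z0, delta0)).1.

Definition localized_delta (R : realType) (n m : nat)
    (S Z0 delta0 : 'M[R[i]]_n) (i : nat) : 'M[R[i]]_n :=
  (iter i (localized_step m S) (Z0, delta0)).2.

Definition converges_to_inverse_factor (R : realType) (n : nat)
    (S : 'M[R[i]]_n) (Z : nat -> 'M[R[i]]_n) : Prop :=
  exists L : 'M[R[i]]_n,
    L *m L ^t* = invmx S /\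
    spectral_norm (Z i - L) @[i --> \oo] --> (0 : R).

(* [ln] is 0 on nonpositive arguments, and so is division by 0.  Hence the bound
   is 0 when eps >= 1, and also when lambda_min S = lambda_max S. *)
Definition iteration_bound (R : realType) (n m : nat) (S : 'M[R[i]]_n)
    (eps : R) : int :=
  Num.ceil (ln (ln eps / ln (1 - lambda_min S / lambda_max S))
            / ln (m + 1)%:R).

(* The number of iterations needed to reach accuracy [eps] is at most [k].
   A negative [k] means that no iteration is needed. *)
Definition accurate_after (R : realType) (n : nat)
    (delta : nat -> 'M[R[i]]_n) (eps : R) (k : int) : Prop :=
  forall i : nat, k <= i%:Z -> spectral_norm (delta i) < eps.

(* Main.v *)
Require Import Defs.
From mathcomp Require Import ring lra.

(* Each Z_i is Z_0 times a polynomial in the Hermitian matrix delta_0, so delta_i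
   is updated eigenvalue by eigenvalue, by the map h(x) = 1 - (1 - x) p(x)^2,
   where p is the Taylor polynomial of (1 - x)^(-1/2).  The differential equation
   2 (1 - x) p' = p - (2 m + 1) b_m x^m gives h' = (2 m + 1) b_m x^m p, so h has
   nonnegative coefficients, starting at x^(m+1), with sum h(1) = 1: hence
   |h(x)| <= |x|^(m+1) on [-1, 1].  Since diag(I, -I) commutes with Z_0 and
   anticommutes with delta_0, comparing Rayleigh quotients of S yields
   ||delta_0|| <= (kappa - 1) / (kappa + 1), with kappa the condition number. *)

Set Implicit Arguments.
Unset Strict Implicit.
Unset Printing Implicit Defensive.

Import Order.TTheory GRing.Theory Num.Theory numFieldNormedType.Exports.
Local Open Scope classical_set_scope.
Local Open Scope complex_scope.
Local Open Scope sesquilinear_scope.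
Local Open Scope ring_scope.

(** * The Taylor polynomial of (1 - x)^(-1/2) and the residual polynomial h *)

Definition isqrt_poly (F : fieldType) (m : nat) : {poly F} :=
  \poly_(k < m.+1) b_coef F k.

Definition residual_poly (F : fieldType) (m : nat) : {poly F} :=
  1 - (1 - 'X) * isqrt_poly F m ^+ 2.

Lemma b_coef_gt0 (R : realFieldType) (k : nat) : 0 < b_coef R k.
Proof.
elim: k => [|k IH]; first exact: ltr01.
by rewrite /=; apply: mulr_gt0.
Qed.

(** The function (1 - x)^(-1/2) solves 2 (1 - x) y' = y, which is the recurrence 2 (k + 1) b_(k+1) =
    (2 k + 1) b_k; truncation at degree m spoils it only at x^m. *)
Lemma isqrt_poly_deriv (R : realFieldType) (m : nat) :
  ((1 - 'X) * (isqrt_poly R m)^`()) *+ 2 =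
  isqrt_poly R m - ((2 * m + 1)%:R * b_coef R m) *: 'X^m.
Proof.
apply/polyP => k; rewrite coefMn mulrBl mul1r coefB coefXM coefB coefZ coefXn.
rewrite mulr2n !coef_deriv -!(mulr_natr (nth _ _ _)) /isqrt_poly !coef_poly.
case: k => [|k] /=.
  by case: m => [|m] /=; rewrite ?mul0r ?mulr0; lra.
have -> : k.+2%:R = k.+1%:R + 1 :> R by rewrite natr1.
rewrite !ltnS natrD natrM.
(* Below m the recurrence applies, above m every term vanishes, and at m the missing b_(m+1)
   produces the correction term. *)
case: (ltngtP k.+1 m) => [lt_km|lt_mk|<-] /=.
- move: (b_coef R k) (k.+1%:R : R) (ltr0Sn R k) => b c c0.
  by rewrite mulr0 subr0; field; lra.
- by rewrite !mul0r subr0 mulr0 subr0 addr0.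
- move: (b_coef R k) (k.+1%:R : R) (ltr0Sn R k) => b c c0.
  by rewrite mul0r sub0r; field; lra.
Qed.

(** With p for [isqrt_poly R m], the product rule gives p (p - 2 (1 - x) p'), and the differential
    equation evaluates the second factor. *)
Lemma residual_poly_deriv (R : realFieldType) (m : nat) :
  (residual_poly R m)^`() =
  ((2 * m + 1)%:R * b_coef R m) *: ('X^m * isqrt_poly R m).
Proof.
have /(congr1 (fun q => isqrt_poly R m * q)) := isqrt_poly_deriv R m.
rewrite mulrBr -scalerAr [_ * 'X^m]mulrC => E.
rewrite /residual_poly !derivCE.
rewrite -[RHS](subKr (isqrt_poly R m * isqrt_poly R m)) -E.
by ring.
Qed.

(** The constant term is 1 - b_0^2 = 0; any other coefficient has the sign of the corresponding
    coefficient of the derivative. *)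
Lemma residual_poly_coef_ge0 (R : realFieldType) (m k : nat) :
  0 <= (residual_poly R m)`_k.
Proof.
case: k => [|k].
  rewrite /residual_poly coefB coef1 coef0M coefB coef1 coefX expr2 coef0M.
  by rewrite /isqrt_poly coef_poly /= subr0 !mulr1 subrr.
have : 0 <= (residual_poly R m)^`()`_k.
  rewrite residual_poly_deriv coefZ coefXnM /isqrt_poly coef_poly.
  apply: mulr_ge0; first by rewrite mulr_ge0 // ltW // b_coef_gt0.
  by do 2!case: ifP => // _; rewrite ltW // b_coef_gt0.
by rewrite coef_deriv pmulrn_lge0.
Qed.

Lemma residual_poly_coef_eq0 (R : realFieldType) (m k : nat) :
  (k <= m)%N -> (residual_poly R m)`_k = 0.
Proof.
case: k => [|k] le_km.
  rewrite /residual_poly coefB coef1 coef0M coefB coef1 coefX expr2 coef0M.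
  by rewrite /isqrt_poly coef_poly /= subr0 !mulr1 subrr.
have : (residual_poly R m)^`()`_k = 0.
  by rewrite residual_poly_deriv coefZ coefXnM le_km mulr0.
by rewrite coef_deriv => /eqP; rewrite mulrn_eq0 => /eqP.
Qed.

Lemma residual_polyE (F : fieldType) (m : nat) (x : F) :
  (residual_poly F m).[x] = 1 - (1 - x) * (isqrt_poly F m).[x] ^+ 2.
Proof.
rewrite /residual_poly -polyC1 hornerD hornerN hornerM hornerD hornerN hornerX.
by rewrite !hornerC horner_exp.
Qed.

Lemma norm_residual_poly (R : realFieldType) (m : nat) (x : R) :
  `|x| <= 1 -> `|(residual_poly R m).[x]| <= `|x| ^+ m.+1.
Proof.
move=> x1; set r := residual_poly R m.
(* The coefficients sum to 1, so the right-hand side can be spread over them and compared term by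
   term. *)
have r1 : r.[1] = 1 by rewrite /r residual_polyE subrr mul0r subr0.
rewrite horner_coef; apply: (le_trans (ler_norm_sum _ _ _)).
rewrite -[leRHS]mulr1 -[in leRHS]r1 horner_coef mulr_sumr.
apply: ler_sum => k _; rewrite normrM ger0_norm ?residual_poly_coef_ge0 //.
rewrite expr1n mulr1 mulrC; have [le_km|lt_mk] := leqP k m.
  by rewrite residual_poly_coef_eq0 // !mulr0.
rewrite ler_wpM2r ?residual_poly_coef_ge0 // normrX.
by rewrite ler_wiXn2l.
Qed.

(** At a zero y of p the residual is 1, which [norm_residual_poly] excludes when |y| < 1. As p(0) =
    1, the intermediate value theorem then rules out p(x) <= 0. *)
Lemma isqrt_poly_gt0 (R : rcfType) (m : nat) (x : R) :
  `|x| < 1 -> 0 < (isqrt_poly R m).[x].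
Proof.
set p := isqrt_poly R m.
have p0 : p.[0] = 1 by rewrite horner_coef0 /p /isqrt_poly coef_poly.
have nz (y : R) : `|y| < 1 -> p.[y] != 0.
  move=> y1; apply: contraTneq (y1) => py0; rewrite -leNgt.
  have := norm_residual_poly m (ltW y1).
  rewrite residual_polyE -/p py0 expr0n mulr0 subr0 normr1 => /le_trans.
  by apply; rewrite exprS ler_piMr // exprn_ile1 // ltW.
move=> x1; rewrite ltNge; apply/negP => px.
have /orP [x0|x0] := le_total x 0.
- have [|y /andP[xy y0] /eqP py0] := @poly_ivt _ p x 0 x0.
    by rewrite px p0 ler01.
  suff /nz/eqP : `|y| < 1 by [].
  by rewrite ler0_norm //; move: x1; rewrite ler0_norm //; lra.
- have [|y /andP[y0 yx] /eqP py0] := @poly_ivt _ (- p) 0 x x0.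
    by rewrite !hornerN p0 oppr_ge0 oppr_le0 ler01.
  suff /nz/eqP : `|y| < 1 by apply; move: py0; rewrite hornerN; lra.
  by rewrite ger0_norm //; move: x1; rewrite ger0_norm //; lra.
Qed.

(** * The iteration on one eigenvalue x of delta_0 *)

Definition residual_iter (F : fieldType) (m i : nat) (x : F) : F :=
  iter i (horner (residual_poly F m)) x.

(** The eigenvalue, at x, of the polynomial in delta_0 by which Z_0 is multiplied to give Z_i. *)
Definition isqrt_iter (F : fieldType) (m i : nat) (x : F) : F :=
  \prod_(j < i) (isqrt_poly F m).[residual_iter m j x].

Lemma isqrt_iterS (F : fieldType) (m i : nat) (x : F) :
  isqrt_iter m i.+1 x =
  isqrt_iter m i x * (isqrt_poly F m).[residual_iter m i x].
Proof. by rewrite /isqrt_iter big_ord_recr. Qed.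

(** Scalar form of Z_i^* S Z_i = I - delta_i, with 1 - x in the place of Z_0^* S Z_0. *)
Lemma isqrt_iter_sqr (F : fieldType) (m i : nat) (x : F) :
  (1 - x) * isqrt_iter m i x ^+ 2 = 1 - residual_iter m i x.
Proof.
elim: i => [|i IH]; first by rewrite /isqrt_iter big_ord0 expr1n mulr1.
by rewrite isqrt_iterS exprMn mulrA IH /= residual_polyE subKr.
Qed.

Lemma norm_residual_iter (R : realFieldType) (m i : nat) (x : R) :
  `|x| <= 1 -> `|residual_iter m i x| <= `|x| ^+ (m.+1 ^ i).
Proof.
move=> x1; elim: i => [|i IH]; first by rewrite expn0 expr1.
have d1 : `|residual_iter m i x| <= 1 by rewrite (le_trans IH) ?exprn_ile1.
rewrite /= (le_trans (norm_residual_poly m d1)) //.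
by rewrite expnSr exprM lerXn2r ?nnegrE ?exprn_ge0.
Qed.

Lemma norm_residual_iter_lt1 (R : realFieldType) (m i : nat) (x : R) :
  `|x| < 1 -> `|residual_iter m i x| < 1.
Proof.
move=> x1; apply: le_lt_trans (norm_residual_iter m i (ltW x1)) _.
by rewrite exprn_ilt1 // expn_eq0.
Qed.

Lemma isqrt_iter_gt0 (R : rcfType) (m i : nat) (x : R) :
  `|x| < 1 -> 0 < isqrt_iter m i x.
Proof.
move=> x1; apply: prodr_gt0 => j _.
by rewrite isqrt_poly_gt0 // norm_residual_iter_lt1.
Qed.

Lemma residual_iter_cvg0 (R : realType) (m : nat) (x : R) :
  (1 <= m)%N -> `|x| < 1 -> residual_iter m i x @[i --> \oo] --> (0 : R).
Proof.
move=> m1 x1; apply: norm_cvg0.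
apply: (squeeze_cvgr (f := fun=> 0)); last 2 first.
- exact: cvg_cst.
- have : `| `|x| | < 1 by rewrite normr_id.
  exact: cvg_expr.
apply: nearW => i /=; rewrite normr_ge0 /=.
apply: le_trans (norm_residual_iter m i (ltW x1)) _.
(* Since m + 1 >= 2, the exponent (m + 1)^i exceeds i, so the geometric sequence |x|^i dominates. *)
by rewrite ler_wiXn2l ?(ltW x1) // ltnW // ltn_expl // ltnS.
Qed.

(** By [isqrt_iter_sqr] the square converges to 1 / (1 - x); positivity of the iterates selects the
    root, and the square root is continuous. *)
Lemma isqrt_iter_cvg (R : realType) (m : nat) (x : R) :
  (1 <= m)%N -> `|x| < 1 ->
  isqrt_iter m i x @[i --> \oo] --> (Num.sqrt (1 - x)^-1 : R).
Proof.
move=> m1 x1.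
have x1' : 0 < 1 - x by rewrite subr_gt0 (le_lt_trans (ler_norm x)).
have -> : (fun i => isqrt_iter m i x) =
          (fun i => Num.sqrt ((1 - residual_iter m i x) * (1 - x)^-1)).
  apply/funext => i; rewrite -isqrt_iter_sqr mulrAC mulfV ?gt_eqF // mul1r.
  by rewrite sqrtr_sqr gtr0_norm // isqrt_iter_gt0.
have cvg_sqr : (1 - residual_iter m i x) * (1 - x)^-1 @[i --> \oo]
    --> (1 - 0 : R) * (1 - x)^-1.
  exact: cvgM (cvgB (cvg_cst _) (residual_iter_cvg0 m1 x1)) (cvg_cst _).
rewrite subr0 mul1r in cvg_sqr.
exact: (cvg_comp _ _ cvg_sqr (@sqrt_continuous R _)).
Qed.

(** Undoing the outer logarithm gives ln eps / ln q <= (m + 1)^i; since ln q < 0, this means (m +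
    1)^i ln q <= ln eps. *)
Lemma le_iteration_exponent (R : realType) (m i : nat) (q eps : R) :
  (1 <= m)%N -> 0 < q < 1 -> 0 < eps < 1 ->
  Num.ceil (ln (ln eps / ln q) / ln (m + 1)%:R) <= i%:Z ->
  q ^+ (m.+1 ^ i) <= eps.
Proof.
move=> m1 /andP[q0 q1] /andP[e0 e1].
have lq : ln q < 0 by rewrite ln_lt0 // q0.
have le : ln eps < 0 by rewrite ln_lt0 // e0.
have lm : 0 < ln ((m + 1)%:R : R) by rewrite ln_gt0 // ltr1n addn1 ltnS.
have r0 : 0 < ln eps / ln q by rewrite nmulr_rgt0 // invr_lt0.
rewrite ceil_le_int ler_pdivrMr // mulrzl -pmulrn -lnXn ?ltr0n ?addn1 //.
rewrite ler_ln ?posrE ?exprn_gt0 // ler_ndivrMr // -natrX mulr_natl -lnXn //.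
by rewrite ler_ln ?posrE ?exprn_gt0.
Qed.

(** * Functional calculus in a fixed unitary basis: matrix operations become pointwise operations on
    the eigenvalues *)

Definition real_diag (R : realType) (n : nat) (U : 'M[R[i]]_n) (f : 'I_n -> R) :
    'M[R[i]]_n :=
  U ^t* *m diag_mx (\row_j (f j)%:C) *m U.

Lemma trmxC_mul (R : realType) (n p q : nat) (A : 'M[R[i]]_(n, p))
    (B : 'M[R[i]]_(p, q)) : (A *m B) ^t* = B ^t* *m A ^t*.
Proof. by rewrite trmx_mul map_mxM. Qed.

Lemma trmxCD (R : realType) (n p : nat) (A B : 'M[R[i]]_(n, p)) :
  (A + B) ^t* = A ^t* + B ^t*.
Proof. by rewrite linearD /= map_mxD. Qed.

Lemma trmxCN (R : realType) (n p : nat) (A : 'M[R[i]]_(n, p)) :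
  (- A) ^t* = - A ^t*.
Proof. by rewrite linearN /= map_mxN. Qed.

Lemma trmxC1 (R : realType) (n : nat) : (1%:M : 'M[R[i]]_n) ^t* = 1%:M.
Proof. by rewrite trmx1 map_mx1. Qed.

Lemma trmxC_block (R : realType) (n1 n2 p1 p2 : nat)
    (A : 'M[R[i]]_(n1, p1)) (B : 'M[R[i]]_(n1, p2))
    (C : 'M[R[i]]_(n2, p1)) (D : 'M[R[i]]_(n2, p2)) :
  (block_mx A B C D) ^t* = block_mx (A ^t*) (C ^t*) (B ^t*) (D ^t*).
Proof. by rewrite tr_block_mx map_block_mx. Qed.

Lemma hermsymmxP (R : realType) (n : nat) (A : 'M[R[i]]_n) :
  A \is hermsymmx <-> A ^t* = A.
Proof.
rewrite is_hermitianmxE expr0 scale1r.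
by split=> [/eqP <-|->].
Qed.

Section RealDiag.
Variables (R : realType) (n : nat) (U : 'M[R[i]]_n).
Hypothesis U_unitary : U *m U ^t* = 1%:M.
Implicit Types f g : 'I_n -> R.

Lemma eq_real_diag f g : f =1 g -> real_diag U f = real_diag U g.
Proof. by move=> /funext ->. Qed.

Lemma trmxC_real_diag f : (real_diag U f) ^t* = real_diag U f.
Proof.
rewrite /real_diag !trmxC_mul trmxCK mulmxA tr_diag_mx map_diag_mx.
apply: (congr1 (fun D => U ^t* *m diag_mx D *m U)).
apply/rowP => j; rewrite !mxE; exact: conjc_real.
Qed.

Lemma real_diagM f g :
  real_diag U f *m real_diag U g = real_diag U (fun j => f j * g j).
Proof.
rewrite /real_diag -!mulmxA (mulmxA U) U_unitary mul1mx (mulmxA (diag_mx _)).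
congr (_ *m (_ *m _)); rewrite mulmx_diag; congr diag_mx.
by apply/rowP => j; rewrite !mxE rmorphM.
Qed.

Lemma real_diag1 : real_diag U (fun=> 1) = 1%:M.
Proof.
rewrite /real_diag (_ : \row__ _ = const_mx 1); last first.
  by apply/rowP => j; rewrite !mxE.
by rewrite diag_const_mx mulmx1 (mulmx1C U_unitary).
Qed.

Lemma real_diagB f g :
  real_diag U f - real_diag U g = real_diag U (fun j => f j - g j).
Proof.
rewrite /real_diag -mulmxBl -mulmxBr -raddfB.
apply: (congr1 (fun D => U ^t* *m diag_mx D *m U)).
by apply/rowP => j; rewrite !mxE rmorphB.
Qed.

Lemma real_diagD f g :
  real_diag U f + real_diag U g = real_diag U (fun j => f j + g j).
Proof.
rewrite /real_diag -mulmxDl -mulmxDr -raddfD.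
apply: (congr1 (fun D => U ^t* *m diag_mx D *m U)).
by apply/rowP => j; rewrite !mxE rmorphD.
Qed.

Lemma real_diagZ (c : R) f :
  c%:C *: real_diag U f = real_diag U (fun j => c * f j).
Proof.
rewrite /real_diag scalemxAl scalemxAr -linearZ.
apply: (congr1 (fun D => U ^t* *m diag_mx D *m U)).
by apply/rowP => j; rewrite !mxE rmorphM.
Qed.

Lemma real_diag0 : real_diag U (fun=> 0) = 0.
Proof.
rewrite /real_diag (_ : \row__ _ = 0); last by apply/rowP => j; rewrite !mxE.
by rewrite raddf0 mulmx0 mul0mx.
Qed.

Lemma real_diagX f k : real_diag U f ^+ k = real_diag U (fun j => f j ^+ k).
Proof.
elim: k => [|k IH]; first by rewrite expr0 real_diag1.
rewrite exprS IH; apply: etrans (real_diagM _ _) _.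
by apply: eq_real_diag => j; rewrite exprS.
Qed.

Lemma real_diag_sum (s : seq nat) (F : nat -> 'I_n -> R) :
  \sum_(k <- s) real_diag U (F k) = real_diag U (fun j => \sum_(k <- s) F k j).
Proof.
elim: s => [|k s IH].
  rewrite big_nil -real_diag0; apply: eq_real_diag => j; by rewrite big_nil.
rewrite big_cons IH real_diagD.
by apply: eq_real_diag => j; rewrite big_cons.
Qed.

Lemma real_diag_eigenrow f j : row j U *m real_diag U f = (f j)%:C *: row j U.
Proof.
rewrite /real_diag -row_mul !mulmxA U_unitary mul1mx row_mul row_diag_mx mxE.
by rewrite -scalemxAl -rowE.
Qed.

(** Adjoint of [real_diag_eigenrow]: the matrix is self-adjoint and its eigenvalues are real. *)
Lemma real_diag_eigencol f j :
  real_diag U f *m col j (U ^t*) = (f j)%:C *: col j (U ^t*).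
Proof.
apply: (can_inj (@trmxCK _ _ _)); rewrite trmxC_mul trmxC_real_diag.
have -> : (col j (U ^t*)) ^t* = row j U.
  by apply/rowP => k; rewrite !mxE conjCK.
rewrite real_diag_eigenrow; congr (_^T); apply/rowP => k.
rewrite !mxE rmorphM /= conjCK; congr (_ * _); exact: (esym (conjc_real _)).
Qed.

Lemma real_diag_form f (x : 'cV[R[i]]_n) :
  (x ^t* *m real_diag U f *m x) 0 0 =
  (\sum_j f j * Normc.normc ((U *m x) j 0) ^+ 2)%:C.
Proof.
set y := U *m x.
have -> : x ^t* *m real_diag U f *m x = y ^t* *m diag_mx (\row_j (f j)%:C) *m y.
  by rewrite /y trmxC_mul /real_diag !mulmxA.
rewrite -mulmxA mul_diag_mx mxE rmorph_sum; apply: eq_bigr => j _.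
rewrite !mxE rmorphM rmorphXn mulrCA; congr (_ * _).
by rewrite mulrC; exact/esym/normCK.
Qed.
End RealDiag.

(** * The Euclidean norm *)

Lemma norm2_sqr (R : realType) (n : nat) (x : 'cV[R[i]]_n) :
  norm2 x ^+ 2 = \sum_j Normc.normc (x j 0) ^+ 2.
Proof. by rewrite sqr_sqrtr // sumr_ge0 // => j _; rewrite sqr_ge0. Qed.

Lemma norm2_ge0 (R : realType) (n : nat) (x : 'cV[R[i]]_n) : 0 <= norm2 x.
Proof. exact: sqrtr_ge0. Qed.

Lemma norm2_form (R : realType) (n : nat) (x : 'cV[R[i]]_n) :
  (x ^t* *m x) 0 0 = (norm2 x ^+ 2)%:C.
Proof.
rewrite norm2_sqr mxE rmorph_sum; apply: eq_bigr => j _.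
by rewrite !mxE rmorphXn mulrC; exact/esym/normCK.
Qed.

Lemma norm2_eq0 (R : realType) (n : nat) (x : 'cV[R[i]]_n) : norm2 x = 0 -> x = 0.
Proof.
move=> /(congr1 (fun a => a ^+ 2)); rewrite norm2_sqr expr0n => /eqP.
rewrite psumr_eq0 => [/allP x0|j _]; last exact: sqr_ge0.
apply/colP => j; rewrite mxE; apply: Normc.eq0_normc; apply/eqP.
by rewrite -sqrf_eq0 -[_ ^+ 2 == 0]/(true ==> _) x0 ?mem_index_enum.
Qed.

Lemma norm2_gt0 (R : realType) (n : nat) (x : 'cV[R[i]]_n) :
  x != 0 -> 0 < norm2 x.
Proof.
move=> x0; rewrite lt_neqAle norm2_ge0 andbT.
by apply: contra_neq x0 => x0; exact/norm2_eq0/esym.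
Qed.

Lemma norm2_isometry (R : realType) (n : nat) (U : 'M[R[i]]_n) (x : 'cV[R[i]]_n) :
  U ^t* *m U = 1%:M -> norm2 (U *m x) = norm2 x.
Proof.
move=> Uu; apply/eqP; rewrite -(eqrXn2 (n := 2)) ?norm2_ge0 //; apply/eqP.
apply: (@complexI R); rewrite -!norm2_form trmxC_mul mulmxA -(mulmxA (x ^t*)).
by rewrite Uu mulmx1.
Qed.

(** * Diagonalization, extreme eigenvalues and Rayleigh quotients *)

Lemma hermitian_real_diag (R : realType) (n : nat) (A : 'M[R[i]]_n) :
  A \is hermsymmx ->
  exists U f, U *m U ^t* = 1%:M /\ A = real_diag U f.
Proof.
move=> hA; set U := spectralmx A.
have hU : U \is unitarymx := spectral_unitarymx A.
(* The spectral values of a Hermitian matrix are real, so nothing is lost by taking real parts. *)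
exists U, (fun j => complex.Re (spectral_diag A 0 j)).
split; first exact/unitarymxP.
have /orthomx_spectralP {1}-> := hermitian_normalmx hA.
rewrite (invmx_unitary hU) /real_diag.
apply: (congr1 (fun D => U ^t* *m diag_mx D *m U)).
apply/rowP => j; rewrite mxE RRe_real //.
exact: (mxOverP (hermitian_spectral_diag_real hA)).
Qed.

Lemma eigenvalue_real_diag (R : realType) (n : nat) (U : 'M[R[i]]_n)
    (f : 'I_n -> R) (x : R) :
  U *m U ^t* = 1%:M ->
  eigenvalue (real_diag U f) x%:C <-> exists j, f j = x.
Proof.
move=> Uu; split=> [/eigenvalueP [v vx v0]|[j <-]]; last first.
  apply/eigenvalueP; exists (row j U); first exact: real_diag_eigenrow.
  apply: contra_neq (oner_neq0 R[i]) => Uj0.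
  have <- : (U *m U ^t*) j j = 1 by rewrite Uu mxE eqxx.
  rewrite mxE.
  apply: big1 => k _; move/rowP: Uj0 => /(_ k); rewrite !mxE => ->.
  by rewrite mul0r.
(* In these coordinates the eigenvalue equation reads w_j f_j = x w_j; any nonzero coordinate yields
   the index. *)
pose w := v *m U ^t*.
have w0 : w != 0.
  apply: contra_neq v0 => w0.
  by rewrite -[v]mulmx1 -(mulmx1C Uu) mulmxA -/w w0 mul0mx.
have wx : w *m diag_mx (\row_j (f j)%:C) = x%:C *: w.
  rewrite /w scalemxAl -vx /real_diag -!mulmxA Uu mulmx1.
  by rewrite !mulmxA.
have [j wj0] := rV0Pn _ w0.
exists j; apply: complexI; apply: (mulIf wj0).
by have /rowP/(_ j) := wx; rewrite mul_mx_diag !mxE mulrC.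
Qed.

Lemma normc_real (R : realType) (x : R) : Normc.normc x%:C = `|x|.
Proof. by rewrite /Normc.normc /= expr0n addr0 sqrtr_sqr. Qed.

Section RealSpectrum.
Variables (R : realType) (n : nat) (U : 'M[R[i]]_n) (f : 'I_n -> R).
Hypothesis U_unitary : U *m U ^t* = 1%:M.

Lemma lambda_min_le j : lambda_min (real_diag U f) <= f j.
Proof.
apply: ge_inf; last by apply/(eigenvalue_real_diag _ _ U_unitary); exists j.
(* A crude lower bound of the spectrum, needed for the infimum to be meaningful. *)
exists (- \sum_k `|f k|) => x /(eigenvalue_real_diag _ _ U_unitary) [k <-].
rewrite lerNl; apply: (le_trans (y := `|f k|)).
  by rewrite -normrN ler_norm.
by rewrite (bigD1 k) //= lerDl sumr_ge0.
Qed.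

Lemma lambda_max_ge j : f j <= lambda_max (real_diag U f).
Proof.
apply: ub_le_sup; last by apply/(eigenvalue_real_diag _ _ U_unitary); exists j.
exists (\sum_k `|f k|) => x /(eigenvalue_real_diag _ _ U_unitary) [k <-].
apply: (le_trans (ler_norm (f k))).
by rewrite (bigD1 k) //= lerDl sumr_ge0.
Qed.

Lemma lambda_min_gt0 : (0 < n)%N -> (forall j, 0 < f j) ->
  0 < lambda_min (real_diag U f).
Proof.
move=> n0 f0; pose j0 := Ordinal n0.
(* A smallest f k exists by finiteness; it keeps the infimum strictly positive. *)
case: (@arg_minP _ _ _ j0 xpredT f isT) => k _ fk.
apply: lt_le_trans (f0 k) _; apply: lb_le_inf.
  by exists (f j0); apply/(eigenvalue_real_diag _ _ U_unitary); exists j0.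
by move=> x /(eigenvalue_real_diag _ _ U_unitary) [j <-]; exact: fk.
Qed.

(** The form is the sum of the f j weighted by |(U x)_j|^2, and these weights add up to
    [norm2 x ^+ 2] because U is an isometry. *)
Lemma rayleigh_bounds (x : 'cV[R[i]]_n) (q : R) :
  (x ^t* *m real_diag U f *m x) 0 0 = q%:C ->
  lambda_min (real_diag U f) * norm2 x ^+ 2 <= q
    <= lambda_max (real_diag U f) * norm2 x ^+ 2.
Proof.
rewrite real_diag_form => /complexI <-.
rewrite -(norm2_isometry x (mulmx1C U_unitary)) norm2_sqr !mulr_sumr.
by apply/andP; split; apply: ler_sum => j _;
  rewrite ler_wpM2r ?sqr_ge0 ?lambda_min_le ?lambda_max_ge.
Qed.

Lemma norm2_real_diag_le (c : R) (x : 'cV[R[i]]_n) :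
  0 <= c -> (forall j, `|f j| <= c) ->
  norm2 (real_diag U f *m x) <= c * norm2 x.
Proof.
move=> c0 fc; rewrite -(ler_pXn2r (n := 2)) ?nnegrE ?mulr_ge0 ?norm2_ge0 //.
rewrite -(norm2_isometry x (mulmx1C U_unitary)) /real_diag -!mulmxA.
rewrite norm2_isometry ?trmxCK // exprMn !norm2_sqr mulr_sumr.
apply: ler_sum => j _; rewrite mul_diag_mx !mxE Normc.normcM exprMn.
rewrite ler_wpM2r ?sqr_ge0 //.
by rewrite normc_real lerXn2r ?nnegrE.
Qed.
End RealSpectrum.

(** * The spectral norm *)

Lemma spectral_norm_le (R : realType) (n : nat) (M : 'M[R[i]]_n) (c : R) :
  (0 < n)%N -> (forall x, norm2 x = 1 -> norm2 (M *m x) <= c) ->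
  spectral_norm M <= c.
Proof.
move=> n0 Mc; apply: ge_sup; last by move=> _ [x x1 <-]; exact: Mc.
(* A unit vector, so that the supremum is over a nonempty set. *)
pose e : 'cV[R[i]]_n := delta_mx (Ordinal n0) 0.
exists (norm2 (M *m e)); exists e => //=.
rewrite /norm2 (bigD1 (Ordinal n0)) //= big1 => [|j /negPf j0].
  by rewrite mxE !eqxx Normc.normc1 expr1n addr0 sqrtr1.
by rewrite mxE j0 Normc.normc0 expr0n.
Qed.

Lemma normc_sum (R : realType) (I : finType) (F : I -> R[i]) :
  Normc.normc (\sum_k F k) <= \sum_k Normc.normc (F k).
Proof.
rewrite -lecR rmorph_sum; exact: (ler_norm_sum _ F).
Qed.

Lemma normc_ge0 (R : realType) (z : R[i]) : 0 <= Normc.normc z.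
Proof. by case: z => a b; exact: sqrtr_ge0. Qed.

Lemma norm2_le_sum (R : realType) (n : nat) (x : 'cV[R[i]]_n) :
  norm2 x <= \sum_j Normc.normc (x j 0).
Proof.
have s0 : 0 <= \sum_j Normc.normc (x j 0).
  by rewrite sumr_ge0 // => j _; exact: normc_ge0.
rewrite -(ler_pXn2r (n := 2)) ?nnegrE ?norm2_ge0 // norm2_sqr expr2 mulr_suml.
apply: ler_sum => j _; rewrite expr2 ler_wpM2l ?normc_ge0 //.
rewrite (bigD1 j) //= lerDl sumr_ge0 // => k _; exact: normc_ge0.
Qed.

Lemma normc_le_norm2 (R : realType) (n : nat) (x : 'cV[R[i]]_n) j :
  Normc.normc (x j 0) <= norm2 x.
Proof.
rewrite -(ler_pXn2r (n := 2)) ?nnegrE ?norm2_ge0 ?normc_ge0 // norm2_sqr.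
by rewrite (bigD1 j) //= lerDl sumr_ge0 // => k _; exact: sqr_ge0.
Qed.

(** A crude operator bound: it makes the supremum in [spectral_norm] finite and controls the fixed
    left factor Z_0 in the limit. *)
Lemma norm2_mulmx_le (R : realType) (n : nat) (M : 'M[R[i]]_n) (x : 'cV[R[i]]_n) :
  norm2 (M *m x) <= (\sum_j \sum_k Normc.normc (M j k)) * norm2 x.
Proof.
apply: (le_trans (norm2_le_sum _)); rewrite mulr_suml; apply: ler_sum => j _.
rewrite mxE; apply: (le_trans (normc_sum _)); rewrite mulr_suml.
apply: ler_sum => k _; rewrite Normc.normcM ler_wpM2l ?normc_ge0 //.
exact: normc_le_norm2.
Qed.

Lemma spectral_norm_ge0 (R : realType) (n : nat) (M : 'M[R[i]]_n) :
  0 <= spectral_norm M.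
Proof.
rewrite /spectral_norm; set E := [set _ | _ in _].
have [[y Ey]|/set0P/negP/negPn/eqP ->] := pselect (E !=set0); last by rewrite sup0.
apply: (le_trans (y := y)); first by case: Ey => x _ <-; exact: norm2_ge0.
apply: ub_le_sup => //; exists (\sum_j \sum_k Normc.normc (M j k)).
by move=> _ [x x1 <-]; rewrite (le_trans (norm2_mulmx_le M x)) // x1 mulr1.
Qed.

Lemma spectral_norm_real_diag_lt (R : realType) (n : nat) (U : 'M[R[i]]_n)
    (f : 'I_n -> R) (c : R) :
  (0 < n)%N -> U *m U ^t* = 1%:M -> (forall j, `|f j| < c) ->
  spectral_norm (real_diag U f) < c.
Proof.
move=> n0 Uu fc.
(* The largest |f k| is attained, which preserves strictness through the supremum. *)
case: (@arg_maxP _ _ _ (Ordinal n0) xpredT (fun j => `|f j|) isT) => k _ fk.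
apply: le_lt_trans (fc k); apply: spectral_norm_le => // x x1.
rewrite -[leRHS]mulr1 -x1; apply: norm2_real_diag_le => // j; exact: fk.
Qed.

Lemma spectral_norm_mul_real_diag_cvg0 (R : realType) (n : nat)
    (Z U : 'M[R[i]]_n) (f : nat -> 'I_n -> R) :
  (0 < n)%N -> U *m U ^t* = 1%:M ->
  (forall j, f i j @[i --> \oo] --> (0 : R)) ->
  spectral_norm (Z *m real_diag U (f i)) @[i --> \oo] --> (0 : R).
Proof.
move=> n0 Uu f0; pose K := \sum_j \sum_k Normc.normc (Z j k).
have K0 : 0 <= K.
  by rewrite sumr_ge0 // => j _; rewrite sumr_ge0 // => k _; exact: normc_ge0.
apply: (squeeze_cvgr (f := fun=> 0) (h := fun i => K * \sum_j `|f i j|)).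
- apply: nearW => i; rewrite spectral_norm_ge0 /=.
  apply: spectral_norm_le => // x x1; rewrite -mulmxA.
  apply: (le_trans (norm2_mulmx_le Z _)); rewrite ler_wpM2l //.
  rewrite -[leRHS]mulr1 -x1; apply: norm2_real_diag_le => // [|j].
    by rewrite sumr_ge0.
  by rewrite (bigD1 j) //= lerDl sumr_ge0.
- exact: cvg_cst.
- have limE : K * (\sum_(j < n) `|0 : R|) = 0.
    by rewrite big1 ?mulr0 // => j _; rewrite normr0.
  have lim_sum : K * \sum_j `|f i j| @[i --> \oo] --> K * \sum_(j < n) `|0 : R|.
    apply: cvgMl_tmp; apply: cvg_big => [|j _]; first exact: add_continuous.
    by apply: cvg_norm; exact: f0.
  by rewrite limE in lim_sum.
Qed.

(** * Reduction of both refinements to the scalar iteration *)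

Lemma b_coef_complex (R : realType) (k : nat) : b_coef R[i] k = (b_coef R k)%:C.
Proof.
elim: k => [|k IH]; first by rewrite /= rmorph1.
by rewrite /= IH !rmorphM fmorphV rmorphB rmorphM rmorph_nat rmorph1 rmorph_nat.
Qed.

Lemma isqrt_poly_real_diag (R : realType) (m n : nat) (U : 'M[R[i]]_n)
    (f : 'I_n -> R) :
  U *m U ^t* = 1%:M ->
  \sum_(0 <= k < m.+1) b_coef R[i] k *: real_diag U f ^+ k =
  real_diag U (fun j => (isqrt_poly R m).[f j]).
Proof.
move=> Uu; under eq_bigr do rewrite b_coef_complex real_diagX // real_diagZ.
rewrite real_diag_sum; apply: eq_real_diag => j.
by rewrite /isqrt_poly horner_poly big_mkord.
Qed.

(** The right factor is self-adjoint and diagonal in the same basis as Z^* S Z = I - delta, so it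
    multiplies each 1 - f j by g j ^+ 2. *)
Lemma mulmx_real_diag_error (R : realType) (n : nat) (S Z U : 'M[R[i]]_n)
    (f g : 'I_n -> R) :
  U *m U ^t* = 1%:M -> factorization_error S Z = real_diag U f ->
  factorization_error S (Z *m real_diag U g) =
  real_diag U (fun j => 1 - (1 - f j) * g j ^+ 2).
Proof.
move=> Uu Zf; rewrite /factorization_error trmxC_mul trmxC_real_diag.
have -> : real_diag U g *m Z ^t* *m S *m (Z *m real_diag U g) =
          real_diag U g *m (Z ^t* *m S *m Z) *m real_diag U g.
  by move: (real_diag U g) (Z ^t*) => D Zs; rewrite !mulmxA.
have -> : Z ^t* *m S *m Z = real_diag U (fun j => 1 - f j).
  by rewrite -real_diagB real_diag1 // -Zf /factorization_error subKr.
rewrite !(real_diagM Uu) -(real_diag1 Uu) real_diagB.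
by apply: eq_real_diag => j; ring.
Qed.

Lemma regular_ZS (R : realType) (m n : nat) (S Z0 : 'M[R[i]]_n) (i : nat) :
  regular_Z m S Z0 i.+1 =
  regular_Z m S Z0 i *m \sum_(0 <= k < m.+1)
    b_coef R[i] k *: factorization_error S (regular_Z m S Z0 i) ^+ k.
Proof. by []. Qed.

Lemma regular_real_diag (R : realType) (m n : nat) (S Z0 U : 'M[R[i]]_n)
    (f : 'I_n -> R) (i : nat) :
  U *m U ^t* = 1%:M -> factorization_error S Z0 = real_diag U f ->
  regular_Z m S Z0 i = Z0 *m real_diag U (fun j => isqrt_iter m i (f j)) /\
  regular_delta m S Z0 i = real_diag U (fun j => residual_iter m i (f j)).
Proof.
move=> Uu Z0f.
(* The error formula follows from the formula for Z at the same index, so only the latter needs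
   induction. *)
have errE k :
    regular_Z m S Z0 k = Z0 *m real_diag U (fun j => isqrt_iter m k (f j)) ->
    factorization_error S (regular_Z m S Z0 k) =
    real_diag U (fun j => residual_iter m k (f j)).
  move=> ->; rewrite (mulmx_real_diag_error _ Uu Z0f); apply: eq_real_diag => j.
  by rewrite isqrt_iter_sqr subKr.
suff ZE :
    regular_Z m S Z0 i = Z0 *m real_diag U (fun j => isqrt_iter m i (f j)).
  by split; [exact: ZE|exact: errE].
elim: i => [|i IH].
  have -> : real_diag U (fun j => isqrt_iter m 0 (f j)) = 1%:M.
    by rewrite -(real_diag1 Uu); apply: eq_real_diag => j;
      rewrite /isqrt_iter big_ord0.
  by rewrite mulmx1.
rewrite regular_ZS (errE i IH) (isqrt_poly_real_diag _ _ Uu) IH -mulmxA.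
rewrite (real_diagM Uu).
apply: (congr1 (mulmx Z0)); apply: eq_real_diag => j; exact/esym/isqrt_iterS.
Qed.

(** Splitting (Z + M)^* S (Z + M) into (Z + M)^* S M + M^* S Z + Z^* S Z shows that the localized
    update of delta is exact. *)
Lemma factorization_errorD (R : realType) (n : nat) (S Z M : 'M[R[i]]_n) :
  factorization_error S (Z + M) =
  factorization_error S Z - (Z + M) ^t* *m (S *m M) - (M ^t* *m S) *m Z.
Proof.
rewrite /factorization_error mulmxDr mulmxA.
set c := _ *m S *m M; rewrite trmxCD 2!mulmxDl.
move: (_ *m S *m Z) (_ *m S *m Z) c => a b c.
by rewrite !opprD !addrA [RHS]addrAC.
Qed.

Lemma localized_regular (R : realType) (m n : nat) (S Z0 : 'M[R[i]]_n) (i : nat) :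
  iter i (localized_step m S) (Z0, factorization_error S Z0) =
  (regular_Z m S Z0 i, regular_delta m S Z0 i).
Proof.
elim: i => [|i IH] //=; rewrite IH /localized_step /regular_delta /=.
set Z := regular_Z m S Z0 i; set d := factorization_error S Z.
set p := \sum_(1 <= _ < _) _.
(* Since b_0 = 1, the term k = 0 is the identity and Z + M is the regular update. *)
have -> : \sum_(0 <= k < m.+1) b_coef R[i] k *: d ^+ k = 1%:M + p.
  by rewrite big_nat_recl // [in RHS]/p big_add1 /= expr0 scale1r.
rewrite mulmxDr mulmx1; congr (_, _).
exact/esym/factorization_errorD.
Qed.

(** * Convergence to an inverse factor *)

Lemma regular_converges (R : realType) (m n : nat) (S Z0 U : 'M[R[i]]_n)
    (f : 'I_n -> R) :
  (1 <= m)%N -> (0 < n)%N -> U *m U ^t* = 1%:M ->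
  factorization_error S Z0 = real_diag U f -> (forall j, `|f j| < 1) ->
  converges_to_inverse_factor S (regular_Z m S Z0).
Proof.
(* The limits from [isqrt_iter_cvg]; they satisfy (1 - f j) (g j)^2 = 1, so the limit matrix has
   zero error. *)
move=> m1 n0 Uu Z0f f1; pose g j := Num.sqrt (1 - f j)^-1.
exists (Z0 *m real_diag U g); split.
  set L := Z0 *m _.
  have : factorization_error S L = 0.
    rewrite /L (mulmx_real_diag_error _ Uu Z0f) -(real_diag0 U).
    apply: eq_real_diag => j.
    have fj : 0 < 1 - f j by rewrite subr_gt0 (le_lt_trans (ler_norm _)).
    by rewrite /g sqr_sqrtr ?invr_ge0 ?ltW // mulfV ?subrr // gt_eqF.
  move/eqP; rewrite /factorization_error subr_eq0 eq_sym => /eqP.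
  (* For square matrices one-sided inverses are two-sided: L^* S L = I gives S L L^* = I. *)
  rewrite -mulmxA => LSL; have /mulmx1C := LSL.
  rewrite -mulmxA => SLL.
  have [S_unit _] := mulmx1_unit SLL.
  by rewrite -[LHS]mul1mx -(mulVmx S_unit) -mulmxA SLL mulmx1.
have -> : (fun i => spectral_norm (regular_Z m S Z0 i - Z0 *m real_diag U g)) =
  (fun i => spectral_norm (Z0 *m real_diag U (fun j => isqrt_iter m i (f j) - g j))).
  apply/funext => i; have [-> _] := regular_real_diag m i Uu Z0f.
  by rewrite -mulmxBr real_diagB.
apply: spectral_norm_mul_real_diag_cvg0 => // j.
have : isqrt_iter m i (f j) - g j @[i --> \oo] --> g j - g j.
  by apply: cvgB; [exact: isqrt_iter_cvg|exact: cvg_cst].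
by rewrite subrr.
Qed.

(** * Bounding delta_0 by the condition number, and the iteration count *)

Lemma col_trmxC_neq0 (R : realType) (n : nat) (U : 'M[R[i]]_n) (j : 'I_n) :
  U *m U ^t* = 1%:M -> col j (U ^t*) != 0.
Proof.
move=> Uu; apply: contra_neq (oner_neq0 R[i]) => /colP Uj0.
have <- : (U *m U ^t*) j j = 1 by rewrite Uu mxE eqxx.
by rewrite mxE big1 // => k _; have := Uj0 k; rewrite !mxE => ->; rewrite mulr0.
Qed.

Lemma hermitian_posdef_real_diag (R : realType) (n : nat) (S : 'M[R[i]]_n) :
  hermitian_posdef S ->
  exists V g, [/\ V *m V ^t* = 1%:M, S = real_diag V g & forall j, 0 < g j].
Proof.
move=> [S_herm S_pos]; have [V [g [Vu SE]]] := hermitian_real_diag S_herm.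
exists V, g; split=> // j; pose x := col j (V ^t*).
have x0 : x != 0 := col_trmxC_neq0 j Vu.
have := S_pos x x0; rewrite SE -mulmxA real_diag_eigencol // -scalemxAr mxE.
by rewrite norm2_form -rmorphM ltcR pmulr_lgt0 // exprn_gt0 // norm2_gt0.
Qed.

(* J maps an eigenvector of the error for f j to one for - f j, and J commutes
   with Z; so two Rayleigh quotients of S, at vectors of the same norm, are in
   the ratio (1 + f j) / (1 - f j), which is thus at most the condition number. *)
Lemma anticommuting_error_bounds (R : realType) (n : nat)
    (S Z W J U : 'M[R[i]]_n) (f : 'I_n -> R) (j : 'I_n) :
  hermitian_posdef S -> W *m Z = 1%:M ->
  J ^t* *m J = 1%:M -> J *m Z = Z *m J ->
  J ^t* *m factorization_error S Z *m J = - factorization_error S Z ->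
  U *m U ^t* = 1%:M -> factorization_error S Z = real_diag U f ->
  [/\ 0 < lambda_min S, lambda_min S <= lambda_max S, `|f j| < 1 &
      (lambda_min S + lambda_max S) * `|f j| <= lambda_max S - lambda_min S].
Proof.
move=> S_posdef WZ Ju JZ JE Uu ZE.
have [V [g [Vu SE g0]]] := hermitian_posdef_real_diag S_posdef.
have a0 : 0 < lambda_min S.
  by rewrite SE lambda_min_gt0 // (leq_ltn_trans _ (ltn_ord j)).
pose x := col j (U ^t*); pose u := Z *m x.
have x0 : x != 0 := col_trmxC_neq0 j Uu.
have u0 : u != 0.
  by apply: contra_neq x0 => u0; rewrite -[x]mul1mx -WZ -mulmxA -/u u0 mulmx0.
have ZSZ : Z ^t* *m S *m Z = 1%:M - factorization_error S Z.
  by rewrite /factorization_error subKr.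
have Ex : factorization_error S Z *m x = (f j)%:C *: x.
  by rewrite ZE real_diag_eigencol.
have qu : (u ^t* *m S *m u) 0 0 = ((1 - f j) * norm2 x ^+ 2)%:C.
  have -> : u ^t* *m S *m u = x ^t* *m ((Z ^t* *m S *m Z) *m x).
    by rewrite /u trmxC_mul !mulmxA.
  rewrite ZSZ mulmxBl mul1mx Ex -[X in X - _]scale1r -scalerBl -scalemxAr mxE.
  by rewrite norm2_form -[1](rmorph1 (real_complex R)) -rmorphB -rmorphM.
have qJu : ((J *m u) ^t* *m S *m (J *m u)) 0 0 = ((1 + f j) * norm2 x ^+ 2)%:C.
  have -> : (J *m u) ^t* *m S *m (J *m u) =
            x ^t* *m (J ^t* *m (Z ^t* *m S *m Z) *m J *m x).
    by rewrite /u [J *m _]mulmxA JZ !trmxC_mul !mulmxA.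
  rewrite ZSZ mulmxBr mulmx1 mulmxBl Ju JE opprK mulmxDl mul1mx Ex.
  rewrite -[X in X + _]scale1r -scalerDl -scalemxAr mxE.
  by rewrite norm2_form -[1](rmorph1 (real_complex R)) -rmorphD -rmorphM.
have := rayleigh_bounds Vu (f := g) (x := u); rewrite -SE => /(_ _ qu).
have := rayleigh_bounds Vu (f := g) (x := J *m u); rewrite -SE => /(_ _ qJu).
rewrite norm2_isometry //.
move: (exprn_gt0 2 (norm2_gt0 x0)) (exprn_gt0 2 (norm2_gt0 u0)) a0.
move: (norm2 x ^+ 2) (norm2 u ^+ 2) (lambda_min S) (lambda_max S) (f j).
move=> N Q a b t N0 Q0 a0 /andP[l1 r1] /andP[l2 r2].
have ab : a <= b by rewrite -(ler_pM2r Q0) (le_trans l1 r1).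
have b0 : 0 < b := lt_le_trans a0 ab.
have p1 : 0 < (1 + t) by rewrite -(pmulr_lgt0 _ N0) (lt_le_trans _ l1) // mulr_gt0.
have p2 : 0 < (1 - t) by rewrite -(pmulr_lgt0 _ N0) (lt_le_trans _ l2) // mulr_gt0.
(* Both sides, times N, are compared with a b Q: one Rayleigh quotient is used from above, the other
   from below. Then [c2] swaps the roles of u and J u. *)
have c1 : a * (1 + t) <= b * (1 - t).
  by rewrite -(ler_pM2r N0); nra.
have c2 : a * (1 - t) <= b * (1 + t).
  by rewrite -(ler_pM2r N0); nra.
split=> //; first by rewrite ltr_norml; apply/andP; split; lra.
by case: (ger0P t) => _; nra.
Qed.

Lemma accurate_after_iteration_bound (R : realType) (m n : nat)
    (S Z0 U : 'M[R[i]]_n) (f : 'I_n -> R) (eps : R) :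
  (1 <= m)%N -> (0 < n)%N -> U *m U ^t* = 1%:M ->
  factorization_error S Z0 = real_diag U f -> 0 < eps ->
  (forall j, [/\ 0 < lambda_min S, lambda_min S <= lambda_max S, `|f j| < 1 &
      (lambda_min S + lambda_max S) * `|f j| <= lambda_max S - lambda_min S]) ->
  accurate_after (regular_delta m S Z0) eps (iteration_bound m S eps).
Proof.
move=> m1 n0 Uu Z0f e0 fb i le_ki.
have [_ ->] := regular_real_diag m i Uu Z0f.
apply: spectral_norm_real_diag_lt => // j; have [a0 ab f1 fle] := fb j.
(* For eps >= 1 the bound is 0 by default, and every error is already below 1. *)
have [e1|e1] := leP 1 eps.
  exact: lt_le_trans (norm_residual_iter_lt1 m i f1) e1.
have b0 : 0 < lambda_max S := lt_le_trans a0 ab.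
apply: le_lt_trans (norm_residual_iter m i (ltW f1)) _.
have N0 : (m.+1 ^ i != 0)%N by rewrite expn_eq0.
(* Equal extreme eigenvalues also make the bound 0 by default; then delta_0 = 0 and every iterate is
   exact. *)
move: ab; rewrite le_eqVlt => /orP[/eqP ab|ab].
  have f0 : `|f j| = 0.
    apply/eqP; rewrite eq_le normr_ge0 andbT.
    by move: fle; rewrite ab subrr pmulr_rle0 // addr_gt0.
  by rewrite f0 expr0n (negPf N0).
pose q := 1 - lambda_min S / lambda_max S.
have q01 : 0 < q < 1.
  by rewrite subr_gt0 ltr_pdivrMr // mul1r ab gtrBl divr_gt0.
(* With a < b for the extreme eigenvalues, (b - a) / (b + a) < (b - a) / b = q; this strictness
   makes the final accuracy strict. *)
have fq : `|f j| < q.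
  rewrite /q -(ltr_pM2r b0) mulrBl mul1r divfK ?gt_eqF //.
  move: fle ab a0 (normr_ge0 (f j)).
  by move: (lambda_min S) (lambda_max S) `|f j| => a b t *; nra.
apply: (@lt_le_trans _ _ (q ^+ (m.+1 ^ i))).
  by rewrite ltrXn2r ?nnegrE ?normr_ge0 // ltW //; case/andP: q01.
by apply: le_iteration_exponent; rewrite ?e0.
Qed.

(** * Application to the block-diagonal starting matrix *)

Theorem mainTheorem3 (R : realType) (m nA nC : nat)
    (m_ge1 : (1 <= m)%N) (nA_ge1 : (1 <= nA)%N) (nC_ge1 : (1 <= nC)%N)
    (A : 'M[R[i]]_nA) (B : 'M[R[i]]_(nA, nC)) (C : 'M[R[i]]_nC)
    (S : 'M[R[i]]_(nA + nC))
    (S_posdef : hermitian_posdef S)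
    (S_blocks : S = block_mx A B (B ^t*) C)
    (ZA : 'M[R[i]]_nA) (ZC : 'M[R[i]]_nC)
    (ZA_factor : ZA ^t* *m A *m ZA = 1%:M)
    (ZC_factor : ZC ^t* *m C *m ZC = 1%:M) :
  let Z0 : 'M[R[i]]_(nA + nC) := block_mx ZA 0 0 ZC in
  let delta0 : 'M[R[i]]_(nA + nC) :=
    - block_mx 0 (ZA ^t* *m B *m ZC) (ZC ^t* *m B ^t* *m ZA) 0 in
  [/\ spectral_norm (regular_delta m S Z0 0) < 1,
      spectral_norm (localized_delta m S Z0 delta0 0) < 1,
      converges_to_inverse_factor S (regular_Z m S Z0),
      converges_to_inverse_factor S (localized_Z m S Z0 delta0) &
      forall eps : R, 0 < eps ->
        accurate_after (regular_delta m S Z0) eps (iteration_bound m S eps) /\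
        accurate_after (localized_delta m S Z0 delta0) eps
          (iteration_bound m S eps)].
Proof.
move=> Z0 delta0.
have S_herm : S ^t* = S by apply/hermsymmxP; case: S_posdef.
have n0 : (0 < nA + nC)%N by rewrite addn_gt0 nA_ge1.
(* The inverse factorizations of A and C cancel the diagonal blocks, so the localized refinement
   starts from the true error. *)
have errE : factorization_error S Z0 = delta0.
  rewrite /factorization_error /Z0 trmxC_block !trmx0 !map_mx0 S_blocks.
  rewrite !mulmx_block !mul0mx !mulmx0 !addr0 !add0r ZA_factor ZC_factor.
  rewrite scalar_mx_block opp_block_mx add_block_mx !subrr !sub0r.
  by rewrite /delta0 opp_block_mx !oppr0.
have delta0_herm : delta0 \is hermsymmx.
  apply/hermsymmxP; rewrite -errE /factorization_error.
  by rewrite linearB /= map_mxB trmxC1 !trmxC_mul trmxCK S_herm mulmxA.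
have [U [f [Uu dE]]] := hermitian_real_diag delta0_herm.
rewrite dE in errE.
pose J : 'M[R[i]]_(nA + nC) := block_mx 1%:M 0 0 (- 1%:M).
(* A left inverse of Z_0, read off from Z_A^* A Z_A = I and Z_C^* C Z_C = I. *)
pose W : 'M[R[i]]_(nA + nC) := block_mx (ZA ^t* *m A) 0 0 (ZC ^t* *m C).
have fb j : [/\ 0 < lambda_min S, lambda_min S <= lambda_max S, `|f j| < 1 &
    (lambda_min S + lambda_max S) * `|f j| <= lambda_max S - lambda_min S].
  apply: (@anticommuting_error_bounds _ _ S Z0 W J U f j) => //.
  - by rewrite /W /Z0 mulmx_block !mul0mx !mulmx0 !addr0 !add0r ZA_factor ZC_factor
      -scalar_mx_block.
  - rewrite /J trmxC_block !trmx0 !map_mx0 trmxCN !trmxC1 mulmx_block.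
    rewrite !mul0mx !mulmx0 !addr0 !add0r mulmxN mulNmx opprK !mulmx1.
    by rewrite -scalar_mx_block.
  - rewrite /J /Z0 !mulmx_block !mul0mx !mulmx0 !addr0 !add0r.
    by rewrite mulNmx mulmxN !mul1mx !mulmx1.
  - rewrite errE -dE /J trmxC_block !trmx0 !map_mx0 trmxCN !trmxC1.
    rewrite /delta0 !opp_block_mx !oppr0 !mulmx_block.
    rewrite !(mul0mx, mulmx0, addr0, add0r, mulNmx, mulmxN, mul1mx, mulmx1).
    by rewrite ?(oppr0, opprK).
have f1 j : `|f j| < 1 by case: (fb j).
have locE i : iter i (localized_step m S) (Z0, delta0) =
    (regular_Z m S Z0 i, regular_delta m S Z0 i).
  by rewrite dE -errE localized_regular.
have locZE : localized_Z m S Z0 delta0 = regular_Z m S Z0.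
  by apply/funext => i; rewrite /localized_Z locE.
have locdE : localized_delta m S Z0 delta0 = regular_delta m S Z0.
  by apply/funext => i; rewrite /localized_delta locE.
have delta0_lt1 : spectral_norm (regular_delta m S Z0 0) < 1.
  by rewrite /regular_delta errE; exact: spectral_norm_real_diag_lt.
have cvgZ := regular_converges m_ge1 n0 Uu errE f1.
rewrite locZE locdE; split=> // eps eps0.
by split; exact: accurate_after_iteration_bound m_ge1 n0 Uu errE eps0 fb.
Qed.
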